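(* Let $S$ be a semigroup which has a finite kernel $K=(G,\mathbf{P},\Lambda,I)$, and suppose that $S$ is an equational domain in the language $\mathcal{L}_S$. Then $K$ is an equational domain in the language $\mathcal{L}_K$.
   Context: Equational domains. For a semigroup $T$, the language $\mathcal{L}_T$ consists of the multiplication symbol together with a constant symbol for every element of $T$. An $\mathcal{L}_T$-term in the variables $x_1,\dots,x_n$ is a nonempty finite product of variables and constants from $T$. An equation over $\mathcal{L}_T$ is an equality $t=s$ of two $\mathcal{L}_T$-terms, and a system is an arbitrary set of equations in the variables $x_1,\dots,x_n$ ($n$ finite). A subset of $T^n$ is algebraic over $\mathcal{L}_T$ if it is the set of all solutions in $T^n$ of some system over $\mathcal{L}_T$. The semigroup $T$ is an equational domain (e.d.) in the language $\mathcal{L}_T$ if for all $n$ every union $Y_1\cup\dots\cup Y_m$ of finitely many ($m\ge 1$) algebraic subsets of $T^n$ is algebraic. Kernels. The kernel of a semigroup $S$ is its minimal two-sided ideal, if it exists. Kernels are assumed to be completely simple (a finite kernel always is). By the Sushkevich–Rees theorem a completely simple semigroup $K$ is identified with the set of triples $(\lambda,g,i)$, $\lambda\in\Lambda$, $g\in G$, $i\in I$, with multiplication $(\lambda,g,i)(\mu,h,j)=(\lambda,g\,p_{i\mu}h,j)$, where $G$ is a group, $\Lambda,I$ are nonempty index sets each with a distinguished element $1$, and $\mathbf{P}=(p_{i\mu})_{i\in I,\mu\in\Lambda}$ is a matrix with entries in $G$ that is normalized: $p_{1\mu}=p_{i1}=1$ for all $\mu\in\Lambda$, $i\in I$. This is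 written $K=(G,\mathbf{P},\Lambda,I)$. *)

(* Defs.v *)
From HB Require Import structures.
From mathcomp Require Import all_boot.
From mathcomp Require Import boolp classical_sets functions cardinality.

Set Implicit Arguments.
Unset Strict Implicit.
Unset Printing Implicit Defensive.

Local Open Scope classical_set_scope.
Local Open Scope group_scope.

Section EquationalDomain.

Variable T : semigroupType.

(* Products are kept as binary trees; bracketing is irrelevant to evaluation. *)
Inductive term (n : nat) : Type :=
  | Var of 'I_n
  | Const of T
  | Mul of term n & term n.

Fixpoint eval n (x : (T ^ n)%type) (t : term n) : T :=
  match t with
  | Var i => x i
  | Const c => c
  | Mul t1 t2 => eval x t1 * eval x t2
  end.

Definition equation n : Type := (term n * term n)%type.

Definition solutions n (E : set (equation n)) : set (T ^ n)%type :=
  [set x | forall e, E e -> eval x e.1 = eval x e.2].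

Definition algebraic n (Y : set (T ^ n)%type) : Prop :=
  exists E : set (equation n), Y = solutions E.

Definition equational_domain : Prop :=
  forall (n m : nat) (Y : 'I_m.+1 -> set (T ^ n)%type),
    (forall k, algebraic (Y k)) -> algebraic (\bigcup_k Y k).

End EquationalDomain.

Section Kernel.

Variable S : semigroupType.

Definition two_sided_ideal (J : set S) : Prop :=
  J !=set0 /\ forall s x, J x -> J (s * x) /\ J (x * s).

Definition is_kernel (K : set S) : Prop :=
  two_sided_ideal K /\
  forall J, two_sided_ideal J -> J `<=` K -> J = K.

End Kernel.

(* P does not affect the carrier; it is kept so that the multiplication below
   is canonical. *)
Definition rees (G : groupType) (L I : choiceType) (P : I -> L -> G) : Type :=
  (L * G * I)%type.

Definition normalized (G : groupType) (L I : choiceType) (l1 : L) (i1 : I)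
    (P : I -> L -> G) : Prop :=
  (forall l, P i1 l = 1) /\ (forall i, P i l1 = 1).

Section ReesSemigroup.

Variables (G : groupType) (L I : choiceType) (P : I -> L -> G).

Definition rees_mul (x y : rees P) : rees P :=
  let: (l, g, i) := x in
  let: (m, h, j) := y in
  (l, g * P i m * h, j).

Lemma rees_mulA : associative rees_mul.
Proof. by move=> [[l g] i] [[m h] j] [[n k] o]; rewrite /= !mulgA. Qed.

HB.instance Definition _ := Choice.on (rees P).
HB.instance Definition _ := isSemigroup.Build (rees P) rees_mulA.

End ReesSemigroup.

(* Main.v *)
Require Import Defs.
From mathcomp Require Import all_boot.
From mathcomp Require Import boolp classical_sets functions cardinality.

(** Write K for the kernel of [S], identified by [phi] with the Rees matrix
    semigroup [rees P].  The terms of [S] may use constants outside K, which act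
    on K by translations that need not be multiplications by elements of K, so
    equations of [S] cannot be rewritten over K one by one.  The proof passes
    instead through three conditions on the Rees matrix data, which are
    necessary for [S] to be an equational domain and sufficient for K to be one:
    no two columns of [P] are equal ([sandwich_cols_distinct]), no two rows of
    [P] are equal ([sandwich_rows_distinct]), and for all [u] and [v] in [G]
    other than 1, [u] fails to commute with some conjugate of [v]
    ([no_zero_divisors]).

    Necessity.  If [S] is an equational domain, the union of the sets [x = a]
    and [y = c] in [S ^ 2] is algebraic.  So when [a <> b] and [c <> d], some
    equation in two variables holds at (a, c), (a, d), (b, c) but fails at
    (b, d).  This is impossible if the value of a term at (b, d) is always
    determined by its values at the other three points ([term_condition]), which
    is what happens when one of the three conditions is violated.  Equal columns
    give two elements of K that no left factor in K can tell apart; a term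
    evaluated at these two elements then depends on at most one of its
    variables.  Equal rows are the mirror image.  If [u] commutes with all
    conjugates of [v], the normal closures of [u] and [v] commute elementwise,
    and a term whose variables range over [{1, u}] and [{1, v}] splits into a product of a
    part depending on the first variable and a part depending on the second.

    Sufficiency.  Multiplying by constants on both sides moves any element of K
    into the maximal subgroup of the triples [(l1, g, i1)], and under the
    conditions on rows and columns these moves separate the elements of K
    ([coord_inj]).  As [G] is finite, inverses are powers, so each equation
    [t = s] that fails at a point [x] yields a term with values in this subgroup
    that is 1 wherever [t = s] holds but not at [x] ([separating_ratio]).  Given
    a point outside the union of two algebraic sets, take such a term for each
    of them: the equation saying that the first commutes with a suitable
    conjugate of the second holds on the union and fails at the point
    ([rees_equational_domain]). *)

Local Open Scope classical_set_scope.
Local Open Scope group_scope.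

(** * Algebraic sets *)

Lemma algebraic_separated (T : semigroupType) (n : nat) (Y : set (T ^ n)%type) :
  (forall x, ~ Y x -> exists e : equation T n,
     (forall y, Y y -> eval y e.1 = eval y e.2) /\ eval x e.1 <> eval x e.2) ->
  algebraic Y.
Proof.
move=> sepY; exists [set e | forall y, Y y -> eval y e.1 = eval y e.2].
apply/seteqP; split=> [x Yx e Ee|x solx]; first exact: Ee.
by apply: contrapT => /sepY[e [Ee]]; apply; apply: solx.
Qed.

Lemma algebraic_separates (T : semigroupType) (n : nat) (Y : set (T ^ n)%type) x :
  algebraic Y -> ~ Y x -> exists e : equation T n,
    (forall y, Y y -> eval y e.1 = eval y e.2) /\ eval x e.1 <> eval x e.2.
Proof.
move=> [E ->] /existsNP[e /not_implyP[Ee ne]].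
by exists e; split=> // y /(_ e Ee).
Qed.

Lemma equational_domain_setU (T : semigroupType) :
  (forall n (Y Z : set (T ^ n)%type),
     algebraic Y -> algebraic Z -> algebraic (Y `|` Z)) ->
  equational_domain T.
Proof.
move=> algU n; elim=> [|m IHm] Y algY.
  suff -> : \bigcup_k Y k = Y ord0 by [].
  apply/seteqP; split=> [x [k _]|x Yx]; last by exists ord0.
  by rewrite (ord1 k).
suff -> : \bigcup_k Y k = Y ord0 `|` \bigcup_k Y (lift ord0 k).
  by apply: algU => //; apply: IHm.
apply/seteqP; split=> [x [k _]|x [Yx|[k _ Yx]]].
- by case: (unliftP ord0 k) => [j ->|->] Yx; [right; exists j|left].
- by exists ord0.
- by exists (lift ord0 k).
Qed.

Lemma rees_mulE (G : groupType) (L I : choiceType) (P : I -> L -> G)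
    l g i m h j :
  ((l, g, i) : rees P) * ((m, h, j) : rees P) = (l, g * P i m * h, j).
Proof. by []. Qed.

(** * Obstructions to being an equational domain *)

(** The families [R] of 2 by 2 matrices that are closed under entrywise product
    and contain the constants also contain the matrix of values of every term in
    two variables on the square {a, b} x {c, d}. *)
Lemma term_condition (S : semigroupType) (R : set (bool -> bool -> S))
    (a b c d : S) :
  equational_domain S ->
  (forall s, R (fun _ _ => s)) ->
  (forall X Y, R X -> R Y -> R (fun e f => X e f * Y e f)) ->
  R (fun e _ => if e then b else a) ->
  R (fun _ f => if f then d else c) ->
  (forall X Y, R X -> R Y -> (forall e f, ~~ (e && f) -> X e f = Y e f) ->
     X true true = Y true true) ->
  a = b \/ c = d.
Proof.
move=> edS Rconst Rmul Rab Rcd Rdet.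
pose pt e f : (S ^ 2)%type :=
  [ffun i : 'I_2 => if i == ord0 then if e then b else a
                    else if f then d else c].
have Reval (t : term S 2) : R (fun e f => eval (pt e f) t).
  elim: t => [i|s|t Rt t' Rt'] /=; [|exact: Rconst|exact: Rmul].
  have [->|i0] := eqVneq i ord0.
    rewrite (_ : (fun e f => _) = fun e _ => if e then b else a) //.
    by apply/funext => e; apply/funext => f; rewrite ffunE eqxx.
  rewrite (_ : (fun e f => _) = fun _ f => if f then d else c) //.
  by apply/funext => e; apply/funext => f; rewrite ffunE (negPf i0).
pose Y (k : 'I_2) : set (S ^ 2)%type :=
  solutions [set (Var S k, Const 2 (if k == ord0 then a else c))].
have [|E YE] := edS 2%N 1%N Y; first by move=> k; eexists.
have inY e f : (\bigcup_k Y k) (pt e f) <->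
    (if e then b else a) = a \/ (if f then d else c) = c.
  split=> [[k _ /(_ _ erefl)] /=|[ea|fc]].
  - by rewrite ffunE; case: eqP => _; [left|right].
  - by exists ord0 => // _ ->; rewrite /= ffunE eqxx.
  - by exists ord_max => // _ ->; rewrite /= ffunE.
suff : (\bigcup_k Y k) (pt true true) by move=> /inY[->|->]; [left|right].
rewrite YE => eq Eeq.
apply: (Rdet (fun e f => eval (pt e f) eq.1) (fun e f => eval (pt e f) eq.2)).
- exact: Reval.
- exact: Reval.
move=> e f nef.
have : (\bigcup_k Y k) (pt e f).
  by apply/inY; case: e f nef => [] [] // _; [right|left|left].
by rewrite YE; apply.
Qed.

(** If [a] and [b] are not told apart by left factors in [K], neither are [s * a]
    and [s * b] for a constant [s] outside [K], because [z * s] is in [K] for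
    every [z] in [K].  Hence in a term evaluated at [a] and [b] at most the
    leftmost variable influences the value.  Taking [op] to
    be the multiplication or its opposite covers left and right factors at
    once. *)
Lemma ideal_translation_inj (S : semigroupType) (K : set S) (op : S -> S -> S)
    (a b : S) :
  op = (fun x y => x * y) \/ op = (fun x y => y * x) ->
  two_sided_ideal K -> equational_domain S -> K a -> K b ->
  (forall z, K z -> op z a = op z b) -> a = b.
Proof.
move=> opE [_ idK] edS Ka Kb ab.
have opA x y z : op x (op y z) = op (op x y) z.
  by case: opE => ->; rewrite mulgA.
have Kop s x : K x -> K (op s x) /\ K (op x s).
  by move=> Kx; case: opE => ->; have [] := idK s x Kx.
(* The first clause says that one of the two variables has no influence; the
   other two make it stable under products: in a product of two matrices with
   entries in [K], the right one can be replaced by one of its entries. *)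
pose R (X : bool -> bool -> S) :=
  [/\ (forall e, X e true = X e false) \/ (forall f, X true f = X false f),
      (exists s, forall e f, X e f = s) \/ forall e f, K (X e f) &
      forall z e f, K z -> op z (X e f) = op z (X false false)].
have Rop X Y : R X -> R Y -> R (fun e f => op (X e f) (Y e f)).
  move=> [Xp [[s Xs]|KX] zX] [Yp KY zY].
    split.
    - by case: Yp => Yp; [left|right] => ?; rewrite !Xs Yp.
    - case: KY => [[s' Ys]|KY]; [left; exists (op s s')|right] => e f.
        by rewrite Xs Ys.
      by have [] := Kop (X e f) _ (KY e f).
    - move=> z e f Kz; rewrite !opA !Xs; apply: zY.
      by have [] := Kop s z Kz.
  have XYE e f : op (X e f) (Y e f) = op (X e f) (Y false false).
    exact: zY.
  split.
  - by case: Xp => Xp; [left|right] => ?; rewrite !XYE Xp.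
  - by right=> e f; have [] := Kop (Y e f) _ (KX e f).
  - by move=> z e f Kz; rewrite !XYE !opA zX.
have [] // := @term_condition S R a b a b edS.
- by move=> s; split=> //; left => //; exists s.
- move=> X Y RX RY; case: opE Rop => -> Rop; first exact: Rop.
  exact: (Rop Y X).
- split; [by left|by right; case|by move=> z [] f Kz //; rewrite ab].
- split; [by right|by right=> e; case|by move=> z e [] Kz //; rewrite ab].
move=> X Y [Xp _ _] [Yp _ _] XY.
have XY00 := XY false false isT; have XY01 := XY false true isT.
have XY10 := XY true false isT.
by case: Xp Yp => Xp [] Yp; move: (Xp true) (Xp false) (Yp true) (Yp false);
  congruence.
Qed.

Section KernelOfEquationalDomain.

Context {S : semigroupType} {G : groupType} {L I : choiceType}.
Context {l1 : L} {i1 : I} {P : I -> L -> G}.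
Variable phi : {multiplicative rees P -> S}.
Hypotheses (normP : normalized l1 i1 P) (phi_inj : injective phi).
Hypotheses (idealK : two_sided_ideal (range phi)) (edS : equational_domain S).

Let P1l l : P i1 l = 1. Proof. exact: normP.1. Qed.
Let Pi1 i : P i l1 = 1. Proof. exact: normP.2. Qed.

Lemma sandwich_cols_distinct l m : (forall i, P i l = P i m) -> l = m.
Proof.
move=> Plm.
suff /phi_inj[] : phi (l, 1, i1) = phi (m, 1, i1) by [].
apply: (@ideal_translation_inj S (range phi) (fun x y => x * y) _ _ (or_introl erefl) idealK edS);
  [by eexists|by eexists|].
move=> _ [[[n g] i] _ <-]; rewrite -!gmulfM; congr (phi _).
by rewrite rees_mulE Plm.
Qed.

Lemma sandwich_rows_distinct i j : (forall l, P i l = P j l) -> i = j.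
Proof.
move=> Pij.
suff /phi_inj[] : phi (l1, 1, i) = phi (l1, 1, j) by [].
apply: (@ideal_translation_inj S (range phi) (fun x y => y * x) _ _ (or_intror erefl) idealK edS);
  [by eexists|by eexists|].
move=> _ [[[n g] k] _ <-]; rewrite -!gmulfM; congr (phi _).
by rewrite rees_mulE Pij.
Qed.

(** Any element of [S] acts on the middle component as a translation of [G], so
    a constant outside the kernel does no more harm to words over [G] than one
    inside.  The reason is that [phi (l, g, i)] factors as
    [phi (l, 1, i1) * phi (l1, g, i)], where only the second factor contains
    [g]. *)
Lemma left_translation s l : exists m a, forall g i,
  s * phi (l, g, i) = phi (m, a * g, i).
Proof.
have [[[[m a] j] _ sE] _] := idealK.2 s (phi (l, 1, i1)) (imageT _ _).
exists m, a => g i.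
have -> : phi (l, g, i) = phi (l, 1, i1) * phi (l1, g, i).
  by rewrite -gmulfM; congr (phi _); rewrite rees_mulE P1l !mul1g.
by rewrite mulgA -sE -gmulfM; congr (phi _); rewrite rees_mulE Pi1 mulg1.
Qed.

Lemma right_translation s i : exists j b, forall g l,
  phi (l, g, i) * s = phi (l, g * b, j).
Proof.
have [_ [[[m b] j] _ sE]] := idealK.2 s (phi (l1, 1, i)) (imageT _ _).
exists j, b => g l.
have -> : phi (l, g, i) = phi (l, g, i1) * phi (l1, 1, i).
  by rewrite -gmulfM; congr (phi _); rewrite rees_mulE P1l !mulg1.
by rewrite -mulgA -sE -gmulfM; congr (phi _); rewrite rees_mulE P1l mulg1.
Qed.

Lemma no_zero_divisors (u v : G) :
  (forall g, commute u (v ^ g)) -> u = 1 \/ v = 1.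
Proof.
move=> uv.
(* [B] is the centralizer of the normal closure of [u], and [A] that of [B]:
   two normal subgroups that commute elementwise, with [u] in [A] and
   [v] in [B]. *)
pose B (b : G) := forall g, commute (u ^ g) b.
pose A (a : G) := forall b, B b -> commute a b.
have commuteJ (x y g : G) : commute x y -> commute (x ^ g) (y ^ g).
  by rewrite /commute -!conjMg => ->.
have BJ b h : B b -> B (b ^ h).
  by move=> Bb g; rewrite -[u ^ g](conjgKV h); apply: commuteJ; rewrite -conjgM.
have AJ a h : A a -> A (a ^ h).
  move=> Aa b Bb; rewrite -[b](conjgKV h); apply: commuteJ; apply: Aa.
  exact: BJ.
have BM b b' : B b -> B b' -> B (b * b') by move=> Bb Bb' g; apply: commuteM.
have AM a a' : A a -> A a' -> A (a * a').
  by move=> Aa Aa' b Bb; apply/commute_sym/commuteM; apply/commute_sym;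
    [apply: Aa|apply: Aa'].
have B1 : B 1 by move=> g; apply: commute1.
have A1 : A 1 by move=> b _; apply/commute_sym/commute1.
(* Normality lets a product of two matrices of this form be brought back to it
   by moving all the factors in [A] and [B] to the right, and commutation sorts
   them.  The entry at [(true, true)] is determined by the other three because
   these determine the outer components, [g], [a] and [b]. *)
pose form (X : bool -> bool -> S) := exists l g i a b,
  [/\ A a, B b &
      forall e f : bool, X e f = phi (l, g * (a ^+ e * b ^+ f), i)].
pose R (X : bool -> bool -> S) := (exists s, forall e f, X e f = s) \/ form X.
have Rmul X Y : R X -> R Y -> R (fun e f => X e f * Y e f).
  move=> [[s Xs]|[l [g [i [a [b [Aa Bb XE]]]]]]].
    move=> [[s' Ys]|[m [h [j [a' [b' [Aa' Bb' YE]]]]]]].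
      by left; exists (s * s') => e f; rewrite Xs Ys.
    have [n [c sE]] := left_translation s m.
    right; exists n, (c * h), j, a', b'; split=> // e f.
    by rewrite Xs YE sE mulgA.
  move=> [[s Ys]|[m [h [j [a' [b' [Aa' Bb' YE]]]]]]].
    have [j [c sE]] := right_translation s i.
    right; exists l, (g * c), j, (a ^ c), (b ^ c).
    split; [exact: AJ|exact: BJ|move=> e f].
    rewrite XE Ys sE; congr (phi (_, _, _)).
    by rewrite -!conjXg -conjMg conjgE !mulgA mulgK.
  pose q := P i m * h.
  right; exists l, (g * q), j, (a ^ q * a'), (b ^ q * b').
  split; [exact: AM (AJ _ _ Aa) Aa'|exact: BM (BJ _ _ Bb) Bb'|move=> e f].
  rewrite XE YE -gmulfM; congr (phi _); rewrite rees_mulE.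
  have -> : (a ^ q * a') ^+ e = a ^+ e ^ q * a' ^+ e.
    by case: e; rewrite ?expg1 ?expg0 ?conj1g ?mulg1.
  have -> : (b ^ q * b') ^+ f = b ^+ f ^ q * b' ^+ f.
    by case: f; rewrite ?expg1 ?expg0 ?conj1g ?mulg1.
  have swap (x y z w : G) : commute y z -> x * y * (z * w) = x * z * (y * w).
    by move=> yz; rewrite !mulgA -(mulgA x y) yz mulgA.
  rewrite (swap _ (a' ^+ e)); last first.
    by rewrite conjXg; apply: commuteX2; apply: Aa'; apply: BJ.
  rewrite -conjMg.
  congr (_, _, _).
  by rewrite conjgE /q !invgM !mulgA !mulgK ?mulgVK.
have [||||||] := @term_condition S R (phi (l1, 1, i1)) (phi (l1, u, i1))
  (phi (l1, 1, i1)) (phi (l1, v, i1)) edS.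
- by move=> s; left; exists s.
- exact: Rmul.
- right; exists l1, 1, i1, u, 1; split=> //.
    by move=> b Bb; have := Bb 1; rewrite conjg1.
  by case=> f; rewrite expg1n mul1g mulg1.
- right; exists l1, 1, i1, 1, v; split=> //.
    by move=> g; rewrite -[v](conjgKV g); apply: commuteJ.
  by move=> e; case; rewrite expg1n !mul1g.
- have const_form s : range phi s -> form (fun _ _ => s).
    move=> [[[l g] i] _ <-]; exists l, g, i, 1, 1; split=> // e f.
    by rewrite !expg1n !mulg1.
  have det X Y : form X -> form Y ->
      (forall e f, ~~ (e && f) -> X e f = Y e f) -> X true true = Y true true.
    move=> [l [g [i [a [b [Aa Bb XE]]]]]] [m [h [j [a' [b' [Aa' Bb' YE]]]]]] XY.
    have := XY false false isT; have := XY false true isT.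
    have := XY true false isT; rewrite !XE !YE !expg0 !expg1 !mulg1 !mul1g.
    move=> /phi_inj[_ ga _] /phi_inj[_ gb _] /phi_inj[-> gh ->].
    by rewrite gh in ga gb *; rewrite (mulgI _ _ _ ga) (mulgI _ _ _ gb).
  move=> X Y [[s Xs]|fX] [[s' Ys]|fY] XY.
  - by rewrite Xs -(Xs false false) XY // !Ys.
  - have -> : X = fun _ _ => s by apply/funext=> e; apply/funext.
    apply: det => //; last by move=> e f /XY<-; rewrite Xs.
    apply: const_form; rewrite -(Xs false false) XY //.
    by have [m [h [j [a' [b' [_ _ ->]]]]]] := fY; eexists.
  - have -> : Y = fun _ _ => s' by apply/funext=> e; apply/funext.
    apply: det => //; last by move=> e f /XY->; rewrite Ys.
    apply: const_form; rewrite -(Ys false false) -XY //.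
    by have [m [h [j [a' [b' [_ _ ->]]]]]] := fX; eexists.
  - exact: det.
- by move=> /phi_inj[<-]; left.
- by move=> /phi_inj[<-]; right.
Qed.

End KernelOfEquationalDomain.

(** * Commutators as terms over a Rees matrix semigroup *)

(** Inverses by a positive exponent: semigroup terms have no unit. *)
Lemma finite_group_exponent (G : groupType) : finite_set [set: G] ->
  exists N, forall g : G, g ^+ N.+1 = g^-1.
Proof.
move=> /finite_seqP[s sE].
have sG (g : G) : g \in s by have : [set: G] g by []; rewrite sE.
have order g : exists k, g ^+ k.+1 = 1 :> G.
  have : ~~ uniq [seq g ^+ k | k <- iota 0 (size s).+1].
    apply/negP => /uniq_leq_size => /(_ s) /(_ (fun x _ => sG x)).
    by rewrite size_map size_iota ltnn.
  move=> /(uniqPn 1)[i [j [ij]]]; rewrite size_map size_iota => js.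
  have is_ := ltn_trans ij js.
  rewrite !(nth_map 0%N) ?size_iota // !nth_iota // !add0n => gij.
  exists (j - i).-1; rewrite prednK ?subn_gt0 //.
  by rewrite expgnFr ?(ltnW ij) // -gij mulgV.
have [k killk] : exists k, forall g : G, g \in s -> g ^+ k.+1 = 1.
  elim: s {sE sG} => [|g s [k IH]]; first by exists 0%N.
  have [m gm] := order g.
  exists (m.+1 * k.+1).-1 => h; rewrite prednK ?muln_gt0 // inE => /predU1P[->|hs].
    by rewrite expgnA gm expg1n.
  by rewrite mulnC expgnA IH // expg1n.
(* The exponent [k.*2.+1] is one less than [k.+1 * 2]; doubling keeps it
   positive when [k] is 0. *)
exists k.*2 => g; apply: (mulgI g); rewrite -expgS mulgV.
by rewrite -doubleS -muln2 expgnA killk // expg1n.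
Qed.

(** The power of exponent [k.+1]. *)
Fixpoint term_pow (T : semigroupType) n (t : term T n) (k : nat) : term T n :=
  if k is k'.+1 then Mul t (term_pow T n t k') else t.
Arguments term_pow {T n}.

Section ReesEquationalDomain.

Context {G : groupType} {L I : choiceType} {l1 : L} {i1 : I} {P : I -> L -> G}.
Hypotheses (normP : normalized l1 i1 P) (finG : finite_set [set: G]).
Hypothesis cols : forall l m, (forall i, P i l = P i m) -> l = m.
Hypothesis rows : forall i j, (forall l, P i l = P j l) -> i = j.
Hypothesis nozd : forall u v : G,
  (forall g, commute u (v ^ g)) -> u = 1 \/ v = 1.

Local Notation T := (rees P).

(** By normalization the embedding of [G] as a maximal subgroup of [T]. *)
Definition grp (g : G) : T := (l1, g, i1).

Lemma grpM g h : grp g * grp h = grp (g * h).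
Proof. by rewrite rees_mulE normP.1 mulg1. Qed.

(** The middle component of the product of [x] with [(l1, 1, i)] on the left and
    [(l, 1, i1)] on the right, which lies in the image of [grp]. *)
Definition coord (i : I) (l : L) (x : T) : G :=
  let: (m, g, j) := x in P i m * g * P j l.

Lemma coord_inj x y : (forall i l, coord i l x = coord i l y) -> x = y.
Proof.
case: x y => [[l g] i] [[m h] j] /= xy.
have gh : g = h by have := xy i1 l1; rewrite !normP.1 !normP.2 !mulg1 !mul1g.
rewrite -gh in xy *; congr (_, _, _).
  by apply: cols => k; have := xy k l1; rewrite !normP.2 !mulg1 => /mulIg.
by apply: rows => k; have := xy i1 k; rewrite !normP.1 !mul1g => /mulgI.
Qed.

Lemma coord_term n (t : term T n) i l :
  exists t', forall x, eval x t' = grp (coord i l (eval x t)).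
Proof.
exists (Mul (Const n ((l1, 1, i) : T)) (Mul t (Const n ((l, 1, i1) : T)))) => x /=.
by case: (eval x t) => [[m g] j]; rewrite rees_mulE !mul1g !mulg1 mulgA.
Qed.

Lemma ratio_term n (t t' : term T n) (p q : (T ^ n)%type -> G) :
  (forall x, eval x t = grp (p x)) -> (forall x, eval x t' = grp (q x)) ->
  exists r, forall x, eval x r = grp (p x * (q x)^-1).
Proof.
move=> tE t'E; have [N invE] := finite_group_exponent G finG.
exists (Mul t (term_pow t' N)) => x /=.
have -> : eval x (term_pow t' N) = grp (q x ^+ N.+1).
  elim: N {invE} => [|N IH] /=; first by rewrite t'E expg1.
  by rewrite t'E IH grpM -expgS.
by rewrite tE grpM invE.
Qed.

Lemma separating_ratio n (Y : set (T ^ n)%type) x : algebraic Y -> ~ Y x ->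
  exists (r : term T n) (u : (T ^ n)%type -> G),
    [/\ forall y, eval y r = grp (u y), forall y, Y y -> u y = 1 & u x <> 1].
Proof.
move=> algY /(algebraic_separates _ _ _ _ algY)[[t s] [Yts xts]].
have [i /existsNP[l xil]] : exists i, ~ forall l,
    coord i l (eval x t) = coord i l (eval x s).
  by apply/existsNP => xts'; apply: xts; apply: coord_inj.
have [t' t'E] := coord_term n t i l; have [s' s'E] := coord_term n s i l.
have [r rE] := ratio_term _ _ _ _ _ t'E s'E.
exists r, (fun y => coord i l (eval y t) * (coord i l (eval y s))^-1).
split; first exact: rE.
  by move=> y /Yts /= ->; apply: mulgV.
by move=> /= /divg1_eq/xil.
Qed.

Lemma rees_equational_domain : equational_domain T.
Proof.
apply: equational_domain_setU => n Y Z algY algZ.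
apply: algebraic_separated => x /not_orP[nYx nZx].
have [r [u [rE Yu ux]]] := separating_ratio n Y x algY nYx.
have [s [v [sE Zv vx]]] := separating_ratio n Z x algZ nZx.
have [g nuv] : exists g, ~ commute (u x) (v x ^ g).
  by apply/existsNP => /nozd[].
pose w := Mul (Const n (grp g^-1)) (Mul s (Const n (grp g))).
have wE y : eval y w = grp (v y ^ g).
  by rewrite -[LHS]/(grp g^-1 * (eval y s * grp g)) sE (grpM (v y)) grpM.
exists (Mul r w, Mul w r); rewrite /fst /snd.
have rwE y : eval y (Mul r w) = grp (u y * v y ^ g).
  by rewrite -[LHS]/(eval y r * eval y w) wE rE grpM.
have wrE y : eval y (Mul w r) = grp (v y ^ g * u y).
  by rewrite -[LHS]/(eval y w * eval y r) wE rE grpM.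
split=> [y YZy|]; rewrite rwE wrE; last by move=> [] /nuv.
case: YZy => [/Yu->|/Zv->]; first by rewrite mulg1 mul1g.
by rewrite conj1g mulg1 mul1g.
Qed.

End ReesEquationalDomain.

Theorem theorem4p5 (S : semigroupType) (K : set S)
    (G : groupType) (L I : choiceType) (l1 : L) (i1 : I) (P : I -> L -> G)
    (phi : {multiplicative rees P -> S}) :
  is_kernel K -> finite_set K ->
  normalized l1 i1 P ->
  injective phi -> range phi = K ->
  equational_domain S -> equational_domain (rees P).
Proof.
move=> [idealK _] finK normP phi_inj KE edS; rewrite -KE in idealK finK.
have finG : finite_set [set: G].
  have finT : finite_set [set: rees P].
    have -> : [set: rees P] = phi @^-1` range phi.
      by apply/seteqP; split=> // x _; exists x.
    by apply: finite_preimage finK => x y _ _ /phi_inj.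
  have -> : [set: G] = (fun x : rees P => x.1.2) @` setT.
    by apply/seteqP; split=> // g _; exists (l1, g, i1).
  exact: finite_image.
apply: (rees_equational_domain normP finG).
- exact: (sandwich_cols_distinct phi phi_inj idealK edS).
- exact: (sandwich_rows_distinct phi phi_inj idealK edS).
- exact: (no_zero_divisors phi normP phi_inj idealK edS).
Qed.
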